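(* Let $n,k$ be integers with $3\leq k\leq n$. There exists an integer relative Heffter array $\mathrm{H}_k(n;k)$ if and only if one of the following holds: (1) $k$ is odd and $n\equiv 0,3\pmod 4$; (2) $k\equiv 2\pmod 4$ and $n$ is even; (3) $k\equiv 0\pmod 4$.
   Context: Let $n,k,t$ be positive integers with $t$ dividing $2nk$, and let $J=\left\langle \frac{2nk+t}{t}\right\rangle$ be the subgroup of $\mathbb{Z}_{2nk+t}$ of order $t$. A Heffter array over $\mathbb{Z}_{2nk+t}$ relative to $J$, denoted by $\mathrm{H}_t(n;k)$, is an $n\times n$ partially filled array $A$ (cells may be empty) with entries in $\mathbb{Z}_{2nk+t}$ such that: (a) each row and each column contains exactly $k$ filled cells; (b) for every $x\in\mathbb{Z}_{2nk+t}\setminus J$, exactly one of $x$ and $-x$ appears in $A$ (since there are $nk$ filled cells and $nk$ pairs $\{x,-x\}$ outside $J$, each such pair is thus represented by exactly one cell and no entry lies in $J$); (c) the entries of every row and every column sum to zero in $\mathbb{Z}_{2nk+t}$. An $\mathrm{H}_t(n;k)$ is called integer if, when its entries are viewed as integers in $\pm\{1,\dots,\lfloor\frac{2nk+t}{2}\rfloor\}$ (which avoid the multiples of $\frac{2nk+t}{t}$), the entries of every row and every column sum to zero in $\mathbb{Z}$. Here $t=k$, so the group is $\mathbb{Z}_{2nk+k}$ and $J=\langle 2n+1\rangle$ is its subgroup of order $k$. *)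

(* Defs.v *)
From mathcomp Require Import all_boot all_order all_algebra all_fingroup.

Set Implicit Arguments.
Unset Strict Implicit.
Unset Printing Implicit Defensive.

Import GRing.Theory.
Local Open Scope ring_scope.

(* For n, k, t > 0 we have heffter_modulus n k t > 1, so that
   'Z_(heffter_modulus n k t) is indeed the ring of integers modulo 2nk + t. *)
Definition heffter_modulus (n k t : nat) : nat := (2 * n * k + t)%N.

(* A cell equal to None is empty. *)
Definition pf_array (T : Type) (n : nat) : Type := 'M[option T]_n.

(* 'Z_m carries its additive group structure as a finGroupType, so <[x]> is
   the additive subgroup generated by x. *)
Definition heffter_subgroup (n k t : nat) : {set 'Z_(heffter_modulus n k t)} :=
  <[((heffter_modulus n k t %/ t)%:R : 'Z_(heffter_modulus n k t))%R]>%g.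

Definition appears (T : eqType) (n : nat) (A : pf_array T n) (x : T) : bool :=
  [exists i, exists j, A i j == Some x].

Definition line_filling (T : Type) (n k : nat) (A : pf_array T n) : Prop :=
  (forall i, #|[set j | isSome (A i j)]| = k) /\
  (forall j, #|[set i | isSome (A i j)]| = k).

(* Each entry x is read as the element f x of V; empty cells contribute 0. *)
Definition line_sums_zero (T : Type) (V : zmodType) (f : T -> V) (n : nat)
    (A : pf_array T n) : Prop :=
  (forall i, \sum_j oapp f 0 (A i j) = 0) /\
  (forall j, \sum_i oapp f 0 (A i j) = 0).

Definition relative_heffter (n k t : nat)
    (A : pf_array 'Z_(heffter_modulus n k t) n) : Prop :=
  [/\ line_filling k A,
      forall x : 'Z_(heffter_modulus n k t), x \notin heffter_subgroup n k t ->
        appears A x (+) appears A (- x)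
    & line_sums_zero id A].

(* The representative of x in {- floor (m/2), ..., floor (m/2)}. The only class
   with two such representatives is that of m/2 when m is even. For m = 2nk + t
   with t dividing 2nk, that class and the class of 0 lie in J, so they are not
   entries of a relative Heffter array. *)
Definition signed_rep (m : nat) (x : 'Z_m) : int :=
  if (x <= m %/ 2)%N then x%:Z else x%:Z - m%:Z.

Definition integer_relative_heffter (n k t : nat)
    (A : pf_array 'Z_(heffter_modulus n k t) n) : Prop :=
  relative_heffter A /\ line_sums_zero (@signed_rep (heffter_modulus n k t)) A.

(* Main.v *)
(* Necessity: the absolute values of the entries are the nk integers below
   k(2n+1)/2 that are not multiples of 2n+1, and since the entries add up to 0 the
   sum of these values must be even.

   Sufficiency: cut the values into k runs of n consecutive integers.  Four
   consecutive runs fill four further diagonals with zero line sums, the signs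
   being + - - +, so it suffices to treat k = 0, 3, 5, 6.  For k = 6 and n even the
   array is built from 2 x 2 blocks.  For k = 3 it amounts to a cyclic arrangement
   of signed integers whose consecutive sums are prescribed up to sign and order,
   which zigzags 1, n, 2, n-1, .. provide as for graceful labellings of cycles.
   For k = 5 two more diagonals are added whose effect on the line sums is +1 or -1
   except in one line, and the zigzags are adapted accordingly. *)
Require Import Defs.
From mathcomp Require Import all_boot all_order all_algebra all_fingroup.
From mathcomp Require Import zify.

Set Implicit Arguments.
Unset Strict Implicit.
Unset Printing Implicit Defensive.

Import GRing.Theory Num.Theory.
Local Open Scope ring_scope.

(** * Signed representatives and the runs of admissible absolute values *)

Lemma intr_signed_rep (m : nat) (x : 'Z_m) : (1 < m)%N -> (signed_rep x)%:~R = x.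
Proof.
move=> m_gt1; rewrite /signed_rep; case: ifP => _.
  by rewrite -pmulrn natr_Zp.
by rewrite intrB -!pmulrn natr_Zp pchar_Zp // subr0.
Qed.

Lemma signed_rep_intr (m : nat) (z : int) :
  (1 < m)%N -> (2 * `|z| < m)%N -> signed_rep (z%:~R : 'Z_m) = z.
Proof.
move=> m_gt1 zm; rewrite /signed_rep.
have [z_ge0|z_lt0] := lerP 0 z.
  have -> : (z%:~R : 'Z_m) = (`|z|%N)%:R by rewrite pmulrn gez0_abs.
  rewrite val_Zp_nat // modn_small; last by lia.
  by case: ifP; lia.
have -> : (z%:~R : 'Z_m) = (m - `|z|)%N%:R.
  rewrite natrB; last by lia.
  by rewrite pchar_Zp // sub0r [X in - X]pmulrn ltz0_abs // intrN opprK.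
rewrite val_Zp_nat // modn_small; last by lia.
by case: ifP; lia.
Qed.

(* There are two runs of n values between consecutive multiples of 2n + 1; with
   all runs numbered from 0, half_block n c i is the i-th value of run c. *)
Definition half_block (n c i : nat) : nat := (c * n + c./2 + i).+1.

(** Each run has length n and starts at least n after the previous one, so the runs are disjoint
    intervals. *)
Lemma half_block_inj (n c c' i i' : nat) : (i < n)%N -> (i' < n)%N ->
  half_block n c i = half_block n c' i' -> c = c' /\ i = i'.
Proof.
rewrite /half_block => lti lti' e.
have h (a b x y : nat) : (x < n)%N -> (a < b)%N ->
    (a * n + a./2 + x < b * n + b./2 + y)%N.
  move=> ltx ltab; have: (a.+1 * n <= b * n)%N by rewrite leq_mul2r ltab orbT.
  by rewrite mulSn; lia.
case: (ltngtP c c') => [/(h _ _ i i' lti)|/(h _ _ i' i lti')|ecc]; lia.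
Qed.

Lemma half_block_bound (n k c i : nat) : (c < k)%N -> (i < n)%N ->
  (2 * half_block n c i < heffter_modulus n k k)%N.
Proof.
rewrite /half_block /heffter_modulus => ltc lti.
have : (c.+1 * n <= k * n)%N by rewrite leq_mul2r ltc orbT.
by rewrite mulSn; lia.
Qed.

(** Modulo 2n + 1, an even run has the residues 1, .., n and an odd run n + 1, .., 2n. *)
Lemma half_block_ndvd (n c i : nat) : (i < n)%N ->
  ~~ ((2 * n).+1 %| half_block n c i)%N.
Proof.
move=> lti; apply/negP => /dvdnP[q].
rewrite /half_block -{1}(odd_double_half c); case: (odd c); move: c./2 => h e.
  have : ((q - h) * (2 * n).+1 = n + i + 1)%N by rewrite mulnBl -e; nia.
  by case: (q - h)%N => [|[|r]]; nia.
have : ((q - h) * (2 * n).+1 = i + 1)%N by rewrite mulnBl -e; nia.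
by case: (q - h)%N => [|r]; nia.
Qed.

Lemma half_blockP (n k a : nat) : (0 < a)%N -> (2 * a <= heffter_modulus n k k)%N ->
  ~~ ((2 * n).+1 %| a)%N ->
  exists c i, [/\ (c < k)%N, (i < n)%N & a = half_block n c i].
Proof.
rewrite /heffter_modulus => a_gt0 a_le ndvd.
have := divn_eq a (2 * n).+1; have := ltn_pmod a (ltn0Sn (2 * n)).
have : (a %% (2 * n).+1 != 0)%N by [].
move: (a %/ _)%N (a %% _)%N => s t t0 tlt e.
have [tn|tn] := leqP t n.
  exists (2 * s)%N, t.-1; split; [nia | lia |].
  have -> : half_block n (2 * s) t.-1 = (2 * s * n + s + t.-1).+1.
    by rewrite /half_block mul2n doubleK.
  by nia.
exists (2 * s).+1, (t - n.+1)%N; split; [nia | lia |].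
have -> : half_block n (2 * s).+1 (t - n.+1) = ((2 * s).+1 * n + s + (t - n.+1)).+1.
  by rewrite /half_block mul2n /= uphalf_double.
by nia.
Qed.

(** * From diagonal data to a Heffter array *)

(* The filled cells form k disjoint permutation diagonals: diagonal c meets row i
   in column col c i, and column j in row row c j.  The entry of diagonal c in
   row i is v c i. *)
Record layout (n k : nat) (col row : nat -> nat -> nat) : Prop := Layout {
  layout_col : forall c i, (c < k)%N -> (i < n)%N ->
    (col c i < n)%N /\ row c (col c i) = i;
  layout_row : forall c j, (c < k)%N -> (j < n)%N ->
    (row c j < n)%N /\ col c (row c j) = j;
  layout_inj : forall c c' i, (c < k)%N -> (c' < k)%N -> (i < n)%N ->
    col c i = col c' i -> c = c' }.

Record filling (n k : nat) (row : nat -> nat -> nat) (v : nat -> nat -> int) :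
    Prop := Filling {
  filling_row : forall i, (i < n)%N -> \sum_(c < k) v c i = 0;
  filling_col : forall j, (j < n)%N -> \sum_(c < k) v c (row c j) = 0;
  filling_cover : forall c i, (c < k)%N -> (i < n)%N ->
    exists c' i', [/\ (c' < k)%N, (i' < n)%N & `|v c' i'|%N = half_block n c i] }.

(* As many cells as values: hitting every value makes the map a bijection. *)
Lemma cover_bij (X : finType) (T : Type) (f g : X -> T) :
  injective g -> (forall x, exists y, f y = g x) ->
  injective f /\ forall y, exists x, f y = g x.
Proof.
move=> g_inj fg.
have [h fh] : exists h : X -> X, forall x, f (h x) = g x.
  exact: (fin_all_exists fg).
have h_inj : injective h by move=> x y e; apply: g_inj; rewrite -!fh e.
have [h' hK h'K] := injF_bij h_inj.
split=> [x y|y]; last by exists (h' y); rewrite -fh h'K.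
by rewrite -(h'K x) -(h'K y) !fh => /g_inj ->.
Qed.

Section Realization.

Variables (n k : nat) (col row : nat -> nat -> nat) (v : nat -> nat -> int).
Hypotheses (lay : layout n k col row) (fil : filling n k row v).

Definition array_of (T : Type) (F : int -> T) : pf_array T n :=
  \matrix_(i, j) omap (fun c : 'I_k => F (v c i)) [pick c : 'I_k | col c i == j].

Let colP (c : 'I_k) (i : 'I_n) : (col c i < n)%N.
Proof. by case: (layout_col lay (ltn_ord c) (ltn_ord i)). Qed.
Let rowP (c : 'I_k) (i : 'I_n) : (row c i < n)%N.
Proof. by case: (layout_row lay (ltn_ord c) (ltn_ord i)). Qed.
Let cord c i := Ordinal (colP c i).
Let rord c i := Ordinal (rowP c i).

Let eq_col (c : 'I_k) (i j : 'I_n) : (col c i == j) = (i == rord c j).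
Proof.
apply/eqP/eqP => [e|->] /=; last by case: (layout_row lay (ltn_ord c) (ltn_ord j)).
by apply: val_inj => /=; rewrite -e; case: (layout_col lay (ltn_ord c) (ltn_ord i)).
Qed.

Let eq_layer (c c' : 'I_k) (i : 'I_n) : col c i = col c' i -> c = c'.
Proof.
by move=> e; apply: val_inj; apply: (layout_inj lay _ _ (ltn_ord i) e).
Qed.

Lemma array_ofE (T : Type) (F : int -> T) (c : 'I_k) (i : 'I_n) :
  array_of F i (cord c i) = Some (F (v c i)).
Proof.
rewrite mxE; case: pickP => [c' /eqP e /=|/(_ c)]; last by rewrite /= eqxx.
by rewrite (eq_layer e).
Qed.

Lemma array_of_line_filling (T : Type) (F : int -> T) : line_filling k (array_of F).
Proof.
split=> [i|j].
  have inj : injective (cord^~ i) by move=> c c' [] /eq_layer.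
  rewrite -[RHS](card_ord k) -cardsT -(card_imset _ inj); apply: eq_card => j.
  rewrite inE mxE; case: pickP => [c /eqP e|h] /=; apply/esym/imsetP.
    by exists c => //; apply: val_inj.
  by case=> c _ e; move: (h c); rewrite e /= eqxx.
have inj : injective (rord^~ j).
  move=> c c' e; apply: (@eq_layer _ _ (rord c j)).
  have /eqP-> : col c (rord c j) == j by rewrite eq_col.
  by rewrite e; apply/esym/eqP; rewrite eq_col.
rewrite -[RHS](card_ord k) -cardsT -(card_imset _ inj); apply: eq_card => i.
rewrite inE mxE; case: pickP => [c|h] /=; rewrite ?eq_col.
  by move/eqP=> ->; apply/esym/imsetP; exists c.
by apply/esym/imsetP => -[c _ e]; move: (h c); rewrite eq_col e eqxx.
Qed.

Lemma oapp_array_of (T : Type) (V : zmodType) (f : T -> V) (F : int -> T) i j :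
  oapp f 0 (array_of F i j) = \sum_(c < k | col c i == j) f (F (v c i)).
Proof.
rewrite mxE; case: pickP => [c /eqP e|h] /=; last by rewrite big_pred0.
rewrite (big_pred1 c) // => c' /=; rewrite -e.
by apply/eqP/eqP => [/eq_layer|->].
Qed.

Lemma array_of_sums_row (T : Type) (V : zmodType) (f : T -> V) (F : int -> T) i :
  \sum_j oapp f 0 (array_of F i j) = \sum_(c < k) f (F (v c i)).
Proof.
rewrite (eq_bigr _ (fun j _ => oapp_array_of f F i j)).
by rewrite [RHS](partition_big (cord^~ i) xpredT).
Qed.

Lemma array_of_sums_col (T : Type) (V : zmodType) (f : T -> V) (F : int -> T) j :
  \sum_i oapp f 0 (array_of F i j) = \sum_(c < k) f (F (v c (rord c j))).
Proof.
rewrite (eq_bigr _ (fun i _ => oapp_array_of f F i j)).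
rewrite (exchange_big_dep xpredT) //=; apply: eq_bigr => c _.
by rewrite (big_pred1 (rord c j)) // => i; rewrite eq_col.
Qed.

Let val_bij : injective (fun x : 'I_k * 'I_n => `|v x.1 x.2|%N) /\
  forall y : 'I_k * 'I_n, exists x : 'I_k * 'I_n,
    `|v y.1 y.2|%N = half_block n x.1 x.2.
Proof.
apply: cover_bij => [[c i] [c' i'] /= /half_block_inj[]// e e'|[c i] /=].
  by congr pair; apply: val_inj.
have [c' [i' [ltc lti e]]] := filling_cover fil (ltn_ord c) (ltn_ord i).
by exists (Ordinal ltc, Ordinal lti).
Qed.

(** Every entry satisfies 2|v| < m, so its class determines it, and both the integer and the modular
    line sums come from [fil]. Outside J the absolute values of representatives are the run values,
    each carried by one cell. *)
Lemma heffter_of_filling : (0 < k)%N -> (0 < n)%N ->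
  exists A : pf_array 'Z_(heffter_modulus n k k) n, integer_relative_heffter A.
Proof.
move=> k_gt0 n_gt0; set m := heffter_modulus n k k.
have m_gt1 : (1 < m)%N by rewrite /m /heffter_modulus; nia.
have v_small c i : (c < k)%N -> (i < n)%N -> (2 * `|v c i| < m)%N.
  move=> ltc lti; have [x /= ->] := val_bij.2 (Ordinal ltc, Ordinal lti).
  exact: half_block_bound.
have mE : m = (k * (2 * n).+1)%N by rewrite /m /heffter_modulus; lia.
exists (array_of (fun z => z%:~R)); split; last first.
  split=> [i|j]; rewrite (array_of_sums_row, array_of_sums_col).
    rewrite -[RHS](filling_row fil (ltn_ord i)); apply: eq_bigr => c _.
    by rewrite signed_rep_intr // v_small.
  rewrite -[RHS](filling_col fil (ltn_ord j)); apply: eq_bigr => c _.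
  by rewrite signed_rep_intr // v_small.
split; first exact: array_of_line_filling.
- move=> x xJ.
  have appP y : reflect (exists c i, [/\ (c < k)%N, (i < n)%N & v c i = signed_rep y])
      (appears (array_of (fun z => z%:~R : 'Z_m)) y).
    apply: (iffP existsP) => [[i /existsP[j]]|[c [i [ltc lti e]]]].
      rewrite mxE; case: pickP => //= c _ /eqP[] <-.
      by exists c, i; split=> //; rewrite signed_rep_intr // v_small.
    exists (Ordinal lti); apply/existsP; exists (cord (Ordinal ltc) (Ordinal lti)).
    by rewrite array_ofE e intr_signed_rep.
  have sx : (2 * `|signed_rep x| <= m)%N.
    have := ltn_ord x; rewrite /signed_rep [X in (_ < X)%N]Zp_cast // => ltx.
    by case: ifP; lia.
  have sN : (2 * `|signed_rep x| < m)%N -> signed_rep (- x) = - signed_rep x.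
    move=> ?; rewrite -{1}(intr_signed_rep x m_gt1) -intrN signed_rep_intr //.
    by rewrite abszN.
  (* As m = k(2n + 1), the class of 2n + 1 generates J, so a representative divisible by 2n + 1
     would put x in J. *)
  have ndvd : ~~ ((2 * n).+1 %| `|signed_rep x|)%N.
    apply: contra xJ => /dvdnP[q e]; rewrite /heffter_subgroup.
    have -> : (heffter_modulus n k k %/ k = (2 * n).+1)%N by rewrite -/m mE mulKn.
    rewrite -(intr_signed_rep x m_gt1).
    have h : ((2 * n).+1 * q)%N%:R \in <[(2 * n).+1%:R : 'Z_m]>%g.
      by rewrite natrM mulr_natr; apply: (mem_cycle _ q).
    have [s_ge0|s_lt0] := lerP 0 (signed_rep x).
      by rewrite -(gez0_abs s_ge0) e -pmulrn mulnC.
    rewrite -[signed_rep x]opprK -(ltz0_abs s_lt0) e intrN -pmulrn mulnC.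
    by rewrite -/(invg _) groupV.
  have s_gt0 : (0 < `|signed_rep x|)%N.
    by rewrite lt0n; apply: contra ndvd => /eqP->.
  have [c0 [i0 [ltc0 lti0 e0]]] := half_blockP s_gt0 sx ndvd.
  have slt : (2 * `|signed_rep x| < m)%N by rewrite e0 half_block_bound.
  have [c [i [ltc lti e]]] := filling_cover fil ltc0 lti0.
  have ax : appears (array_of (fun z => z%:~R : 'Z_m)) x
         || appears (array_of (fun z => z%:~R : 'Z_m)) (- x).
    have [vs|vs] : v c i = signed_rep x \/ v c i = - signed_rep x by lia.
      by apply/orP; left; apply/appP; exists c, i.
    by apply/orP; right; apply/appP; exists c, i; rewrite sN.
  (* If x and -x both appeared, their cells would share an absolute value, hence coincide, and a
     nonzero integer would equal its negative. *)
  case: (appP x) ax => [[c1 [i1 [ltc1 lti1 e1]]]|] /=; last by move=> _ ->.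
  move=> _; case: (appP (- x)) => // -[c2 [i2 [ltc2 lti2 e2]]].
  have ee : `|v c1 i1|%N = `|v c2 i2|%N by rewrite e1 e2 sN // abszN.
  have [ec ei] :=
    val_bij.1 (Ordinal ltc1, Ordinal lti1) (Ordinal ltc2, Ordinal lti2) ee.
  by move: e1 s_gt0; rewrite ec ei e2 sN //; move: (signed_rep x) => s; lia.
- split=> [i|j]; rewrite (array_of_sums_row, array_of_sums_col) /=.
    by rewrite -raddf_sum (filling_row fil (ltn_ord i)).
  by rewrite -raddf_sum (filling_col fil (ltn_ord j)).
Qed.

End Realization.

(** * Adding four diagonals at a time *)

(* The half-blocks k, .., k+3 start at offsets o, o', o'', o''' with
   o - o' - o'' + o''' = 0, so they fill four diagonals with signs + - - +. *)
Lemma filling_step (n k : nat) row v (tau : nat -> nat) :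
  filling n k row v ->
  (forall i, (i < n)%N -> exists2 i', (i' < n)%N & tau i' = i) ->
  (forall j, (j < n)%N -> row k j + tau (row k.+3 j) = row k.+1 j + tau (row k.+2 j))%N ->
  exists v', filling n k.+4 row v'.
Proof.
move=> [vrow vcol vcov] tau_onto tauE.
(* In a row, i cancels between runs k and k + 1, and [tau i] between runs k + 2 and k + 3. In a
   column the four rows differ, and [tauE] restores the cancellation. *)
pose w c i : int := match (c - k)%N with
  | 0 => (half_block n c i)%:Z | 1 => - (half_block n c i)%:Z
  | 2 => - (half_block n c (tau i))%:Z | _ => (half_block n c (tau i))%:Z end.
have w0 i : w k i = (half_block n k i)%:Z by rewrite /w subnn.
have w1 i : w k.+1 i = - (half_block n k.+1 i)%:Z by rewrite /w subSnn.
have w2 i : w k.+2 i = - (half_block n k.+2 (tau i))%:Z.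
  by rewrite /w (_ : (k.+2 - k = 2)%N) //; lia.
have w3 i : w k.+3 i = (half_block n k.+3 (tau i))%:Z.
  by rewrite /w (_ : (k.+3 - k = 3)%N) //; lia.
exists (fun c i => if (c < k)%N then v c i else w c i); split=> [i lti|j ltj|c i ltc lti].
- rewrite !big_ord_recr /= (eq_bigr (fun c : 'I_k => v c i)); last by move=> c _; rewrite ltn_ord.
  rewrite vrow // !ifF ?w0 ?w1 ?w2 ?w3; try lia.
  by rewrite /half_block !mulSn /= uphalf_half; case: (odd k); lia.
- rewrite !big_ord_recr /= (eq_bigr (fun c : 'I_k => v c (row c j))); last by move=> c _; rewrite ltn_ord.
  rewrite vcol // !ifF ?w0 ?w1 ?w2 ?w3; try lia.
  have := tauE j ltj.
  by rewrite /half_block !mulSn /= uphalf_half; case: (odd k); lia.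
have [ltck|lekc] := ltnP c k.
  have [c' [i' [ltc' lti' e]]] := vcov c i ltck lti.
  by exists c', i'; rewrite ltc'; split=> //; lia.
have [i' lti' tau_i'] := tau_onto i lti.
have : c = k \/ c = k.+1 \/ c = k.+2 \/ c = k.+3 by lia.
case=> [|[|[|]]] ->; [exists k, i | exists k.+1, i | exists k.+2, i' | exists k.+3, i'];
  (rewrite ifF ?w0 ?w1 ?w2 ?w3 ?tau_i' ?abszN; last by lia);
  by split=> //; lia.
Qed.

Lemma filling_iter (n k q : nat) row v :
  filling n k row v ->
  (forall r, (r < q)%N -> exists2 tau : nat -> nat,
     forall i, (i < n)%N -> exists2 i', (i' < n)%N & tau i' = i &
     let c := (k + 4 * r)%N in forall j, (j < n)%N ->
       row c j + tau (row c.+3 j) = row c.+1 j + tau (row c.+2 j))%N ->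
  exists v', filling n (k + 4 * q) row v'.
Proof.
move=> fil; elim: q => [|q IHq] H; first by exists v; rewrite muln0 addn0.
have [r ltr|w filw] := IHq; first by apply: H; lia.
have [tau tau_onto tauE] := H q (ltnSn q).
have -> : (k + 4 * q.+1 = (k + 4 * q).+4)%N by lia.
exact: filling_step filw tau_onto tauE.
Qed.

(** * Circulant arrays *)

(* Addition and subtraction of residues x, y < n modulo n. *)
Definition cadd (n x y : nat) : nat := (if x + y < n then x + y else x + y - n)%N.
Definition csub (n x y : nat) : nat := (if y <= x then x - y else x + n - y)%N.

Lemma circulant_layout (n k : nat) (off : nat -> nat) :
  (forall c, (c < k)%N -> (off c < n)%N) ->
  (forall c c', (c < k)%N -> (c' < k)%N -> off c = off c' -> c = c') ->
  layout n k (fun c i => cadd n i (off c)) (fun c j => csub n j (off c)).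
Proof.
move=> off_lt off_inj; split=> [c i /off_lt ltc lti|c j /off_lt ltc ltj|].
- by rewrite /cadd /csub; do !case: ifP; lia.
- by rewrite /cadd /csub; do !case: ifP; lia.
- move=> c c' i ltc ltc' lti e; apply: off_inj => //.
  have := off_lt c ltc; have := off_lt c' ltc'.
  by move: e; rewrite /cadd; do !case: ifP; lia.
Qed.

(** With [tau] the cyclic shift by s, the row where diagonal c + 2 meets column j goes to the row
    where diagonal c does, and c + 3 likewise to c + 1; both sides of the column condition become
    the same sum. *)
Lemma heffter_circulant (n k q : nat) (off : nat -> nat) v :
  (0 < n)%N -> (0 < k + 4 * q)%N ->
  (forall c, (c < k + 4 * q)%N -> (off c < n)%N) ->
  (forall c c', (c < k + 4 * q)%N -> (c' < k + 4 * q)%N -> off c = off c' -> c = c') ->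
  (forall r, (r < q)%N -> exists2 s, (s < n)%N & let c := (k + 4 * r)%N in
     off c.+2 = cadd n (off c) s /\ off c.+3 = cadd n (off c.+1) s) ->
  filling n k (fun c j => csub n j (off c)) v ->
  exists A : pf_array 'Z_(heffter_modulus n (k + 4 * q) (k + 4 * q)) n,
    integer_relative_heffter A.
Proof.
move=> n_gt0 k_gt0 off_lt off_inj off_quad fil.
have [r ltr|w filw] := filling_iter fil (q := q).
  have [s lts /= [e2 e3]] := off_quad r ltr.
  exists (cadd n ^~ s) => [i lti|j ltj].
    by exists (csub n i s); rewrite /cadd /csub; do !case: ifP; lia.
  rewrite e2 e3.
  have h0 : (off (k + 4 * r) < n)%N by apply: off_lt; lia.
  have h1 : (off (k + 4 * r).+1 < n)%N by apply: off_lt; lia.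
  have tauE x : (x < n)%N -> cadd n (csub n j (cadd n x s)) s = csub n j x.
    by rewrite /cadd /csub; do !case: ifP; lia.
  by rewrite !tauE // addnC.
exact: heffter_of_filling (circulant_layout off_lt off_inj) filw k_gt0 n_gt0.
Qed.

(** * Necessity by parity *)

Lemma odd_sum_absz (I : finType) (P : pred I) (z : I -> int) :
  odd (\sum_(i | P i) `|z i|%N) = odd `|(\sum_(i | P i) z i)%R|.
Proof.
by apply: (big_rec2 (fun a (b : int) => odd a = odd `|b|)) => // i a b _; lia.
Qed.

Lemma heffter_parity (n k : nat) (A : pf_array 'Z_(heffter_modulus n k k) n) :
  (0 < n)%N -> (0 < k)%N -> integer_relative_heffter A ->
  ~~ odd (\sum_(c < k) \sum_(i < n) half_block n c i)%N.
Proof.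
move=> n_gt0 k_gt0 [[fillA appA _] [sumA _]].
have m_gt1 : (1 < heffter_modulus n k k)%N by rewrite /heffter_modulus; nia.
pose P := [set p : 'I_n * 'I_n | isSome (A p.1 p.2)].
pose F p := oapp (@signed_rep (heffter_modulus n k k)) 0 (A p.1 p.2).
have cardP : #|P| = (k * n)%N.
  rewrite -sum1_card (eq_bigl (fun p => isSome (A p.1 p.2))); last by move=> p; rewrite inE.
  rewrite -(pair_big_dep xpredT (fun i j => isSome (A i j)) (fun _ _ => 1%N)) /=.
  rewrite (eq_bigr (fun=> k)) ?sum_nat_const ?card_ord 1?mulnC // => i _.
  by rewrite -[RHS](fillA.1 i) -sum1_card; apply: eq_bigl => j; rewrite inE.
have hP (x : 'I_k * 'I_n) : exists p : 'I_n * 'I_n,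
    p \in P /\ `|F p|%N = half_block n x.1 x.2.
  case: x => c i /=; set a := half_block n c i.
  have a_lt : (2 * a < heffter_modulus n k k)%N by apply: half_block_bound.
  have sa : signed_rep (a%:R : 'Z_(heffter_modulus n k k)) = a%:Z.
    by rewrite pmulrn signed_rep_intr.
  have sNa : signed_rep (- a%:R : 'Z_(heffter_modulus n k k)) = - a%:Z.
    by rewrite pmulrn -intrN signed_rep_intr ?abszN.
  have aJ : (a%:R : 'Z_(heffter_modulus n k k)) \notin heffter_subgroup n k k.
    apply: contra (half_block_ndvd c (ltn_ord i)) => /cycleP[q].
    have mE : heffter_modulus n k k = (k * (2 * n).+1)%N by rewrite /heffter_modulus; lia.
    rewrite [X in (X %/ k)%N]mE mulKn // => /(congr1 val).
    have -> : (((2 * n).+1%:R : 'Z_(heffter_modulus n k k)) ^+ q)%g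
            = ((2 * n).+1 * q)%N%:R by rewrite natrM mulr_natr.
    rewrite /= !val_Zp_nat // -/a modn_small; last by lia.
    move=> ->; rewrite -/(_ %| _)%N [X in (_ %% X)%N]mE.
    by rewrite /dvdn modn_dvdm ?dvdn_mull // -/(_ %| _)%N dvdn_mulr.
  have := appA _ aJ; case: (boolP (appears A _)) => [|_] /=.
    move=> /existsP[i' /existsP[j' /eqP e]] _; exists (i', j').
    by rewrite inE /F /= e /= sa.
  move=> /existsP[i' /existsP[j' /eqP e]]; exists (i', j').
  by rewrite inE /F /= e /= sNa abszN.
(* [h] sends each run value to a cell holding it up to sign. Both sides have kn elements, so the run
   values are exactly the absolute values of the entries. *)
have [h hh] := fin_all_exists hP.
have h_inj : injective h.
  move=> [c i] [c' i'] e; have := (hh (c, i)).2; rewrite e (hh (c', i')).2 /=.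
  by case/half_block_inj=> // ec ei; congr pair; apply: val_inj.
have hT : h @: setT = P.
  apply/eqP; rewrite eqEcard card_imset // cardsT card_prod !card_ord cardP leqnn andbT.
  by apply/subsetP => p /imsetP[x _ ->]; case: (hh x).
rewrite pair_big /= (eq_bigr (fun x => `|F (h x)|%N)); last by move=> x _; rewrite (hh x).2.
have -> : (\sum_x `|F (h x)| = \sum_(p in P) `|F p|)%N.
  rewrite -hT big_imset /=; last by move=> x y _ _; apply: h_inj.
  by apply: eq_bigl => x; rewrite inE.
rewrite odd_sum_absz (_ : \sum_(p in P) F p = 0) //.
rewrite big_mkcond /= (eq_bigr F) => [|p _]; last first.
  by rewrite inE /F; case: (A _ _).
by rewrite -(pair_big xpredT xpredT (fun i j => F (i, j))) big1 // => i _; apply: sumA.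
Qed.

Lemma odd_triangular (n : nat) :
  odd (\sum_(i < n) i.+1)%N = (n %% 4 == 1)%N || (n %% 4 == 2)%N.
Proof.
elim: n => [|n IHn]; first by rewrite big_ord0.
by rewrite big_ord_recr /= oddD IHn /=; lia.
Qed.

(** Runs 2h and 2h + 1 together have a sum of the parity of n. A last run 2h has parity hn + g, and
    its hn cancels against the h preceding pairs, leaving the triangular number g. *)
Lemma odd_sum_half_block (n k : nat) :
  odd (\sum_(c < k) \sum_(i < n) half_block n c i)%N =
  if odd k then (n %% 4 == 1)%N || (n %% 4 == 2)%N else odd k./2 && odd n.
Proof.
pose g := (\sum_(i < n) i.+1)%N; have gE := odd_triangular n; rewrite -/g in gE.
have inner c : (\sum_(i < n) half_block n c i = n * (c * n + c./2) + g)%N.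
  rewrite (eq_bigr (fun i : 'I_n => (c * n + c./2) + i.+1)%N); last first.
    by move=> i _; rewrite /half_block addnS.
  by rewrite big_split /= sum_nat_const card_ord.
rewrite (eq_bigr (fun c : 'I_k => n * (c * n + c./2) + g)%N); last by move=> c _.
have evenE h : odd (\sum_(c < h.*2) (n * (c * n + c./2) + g))%N = odd h && odd n.
  elim: h => [|h IHh]; first by rewrite big_ord0.
  rewrite doubleS !big_ord_recr /= !oddD IHh !oddM !oddD !oddM /= odd_double.
  rewrite doubleK uphalf_double.
  by case: (odd h); case: (odd n); case: (odd g).
move: (odd k) k./2 (odd_double_half k) => [] h <- /=; last by rewrite add0n evenE.
rewrite add1n big_ord_recr /= oddD evenE oddD oddM oddD oddM odd_double doubleK gE.
by case: (odd n); case: (odd h); case: (_ || _).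
Qed.

(** * Fillings of three and of five diagonals *)

Ltac if_lia :=
  repeat match goal with |- context [if ?b then _ else _] => case: (boolP b) => ? end;
  lia.

Lemma csub_ge (n x y : nat) : (y <= x)%N -> csub n x y = (x - y)%N.
Proof. by rewrite /csub => ->. Qed.

Lemma csub_lt (n x y : nat) : (x < y)%N -> csub n x y = (x + n - y)%N.
Proof. by rewrite /csub ltnNge => /negbTE ->. Qed.

(* Every array on three consecutive cyclic diagonals with zero line sums has this
   form: equating the sums of row i and of column i shows that y i - z (i+1) is a
   constant d, where y i and z i are the right and left neighbours of cell (i, i). *)
Definition three_diagonals (n : nat) (y : nat -> int) (d : int) (c i : nat) : int :=
  match c with
  | 0 => y (csub n i 1) - d | 1 => d - y i - y (csub n i 1) | _ => y i end.

Lemma filling_three_diagonals (n : nat) (y : nat -> int) (d : int) :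
  (2 < n)%N ->
  (forall c i, (c < 3)%N -> (i < n)%N -> exists2 i', (i' < n)%N &
     [\/ `|y i'|%N = half_block n c i, `|(y i' - d)%R|%N = half_block n c i
       | `|(y i' + y (csub n i' 1) - d)%R|%N = half_block n c i]) ->
  filling n 3 (fun c j => csub n j c) (three_diagonals n y d).
Proof.
move=> n_gt2 cov; split=> [i lti|j ltj|c i ltc lti].
- by rewrite !big_ord_recr big_ord0 /=; lia.
- rewrite !big_ord_recr big_ord0 /=.
  have -> : csub n j 0 = j by rewrite /csub leq0n subn0.
  have -> : csub n (csub n j 1) 1 = csub n j 2 by rewrite /csub; do !case: ifP; lia.
  by lia.
have [i' lti' []] := cov c i ltc lti => <-; last 1 first.
- by exists 1%N, i'; split=> //=; lia.
- by exists 2%N, i'.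
(* Diagonal 0 holds y i' - d in row i' + 1, not in row i'. *)
exists 0%N, (cadd n i' 1) => /=.
have -> : csub n (cadd n i' 1) 1 = i' by rewrite /cadd /csub; do !case: ifP; lia.
by split=> //; rewrite /cadd; case: ifP; lia.
Qed.

(* Diagonals at offsets 0, 1, -1, b, -b.  If p and r take exactly one of a, -a for
   each 0 < a <= n, then the absolute values M + p, M - p are the half-blocks 1 and
   2, and 2 M + r, 2 M - r the half-blocks 3 and 4; the main diagonal must take the
   values of half-block 0 up to sign. *)
Definition five_diagonals (n b : nat) (p r : nat -> int) (c i : nat) : int :=
  let M := (2 * n).+1%:Z in
  match c with
  | 0 => - (p i + p (csub n i 1) + r i + r (csub n i b))
  | 1 => M + p i | 2 => p (csub n i 1) - M
  | 3 => 2 * M + r i | _ => r (csub n i b) - 2 * M end.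

(** Each [p i] sits in the mirror cells (i, i+1) and (i+1, i), shifted by M and -M, and each [r i]
    likewise at distance b with 2M. Row i and column i thus have equal off-diagonal sums, which one
    diagonal entry cancels. *)
Lemma filling_five_diagonals (n b : nat) (p r : nat -> int) (off : nat -> nat) :
  (2 < n)%N -> (0 < b < n)%N ->
  off 0%N = 0%N -> off 1%N = 1%N -> off 2 = n.-1 -> off 3 = b -> off 4 = (n - b)%N ->
  (forall a, (0 < a <= n)%N -> exists2 i, (i < n)%N & `|p i|%N = a) ->
  (forall a, (0 < a <= n)%N -> exists2 i, (i < n)%N & `|r i|%N = a) ->
  (forall a, (0 < a <= n)%N -> exists2 i, (i < n)%N &
     `|(p i + p (csub n i 1) + r i + r (csub n i b))%R|%N = a) ->
  filling n 5 (fun c j => csub n j (off c)) (five_diagonals n b p r).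
Proof.
move=> n_gt2 hb o0 o1 o2 o3 o4 pcov rcov ecov.
have cK x : (0 < x < n)%N -> forall j, (j < n)%N -> csub n (csub n j (n - x)) x = j.
  by move=> hx j ltj; rewrite /csub; do !case: ifP; lia.
have cK' x : (0 < x < n)%N -> forall j, (j < n)%N ->
    (cadd n j x < n)%N /\ csub n (cadd n j x) x = j.
  by move=> hx j ltj; rewrite /csub /cadd; do !case: ifP; lia.
split=> [i lti|j ltj|c i ltc lti].
- by rewrite !big_ord_recr big_ord0 /=; lia.
- rewrite !big_ord_recr big_ord0 /= o0 o1 o2 o3 o4 -subn1 !cK //; last by lia.
  by rewrite (_ : csub n j 0 = j); [lia | rewrite /csub leq0n subn0].
have h1 : (0 < 1 < n)%N by lia.
have : c = 0%N \/ (c = 1%N \/ c = 2) \/ (c = 3 \/ c = 4) by lia.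
case=> [->|[c12|c34]].
- have [|i' lti' e] := ecov i.+1; first by lia.
  by exists 0%N, i'; split=> //=; rewrite /half_block; lia.
(* Run 1 is M - a with a = n - i, run 2 is M + a with a = i + 1. The sign of [p i'] decides which
   diagonal carries the value. *)
- have [|i' lti' e] := pcov (if c == 1%N then n - i else i.+1)%N; first by case: ifP; lia.
  have [lti2 e2] := cK' _ h1 _ lti'.
  case: c12 e => -> /=; have [hp|hp] := lerP 0 (p i') => e.
  + by exists 2, (cadd n i' 1); rewrite /= e2 /half_block; split=> //; lia.
  + by exists 1%N, i'; rewrite /= /half_block; split=> //; lia.
  + by exists 1%N, i'; rewrite /= /half_block; split=> //; lia.
  + by exists 2, (cadd n i' 1); rewrite /= e2 /half_block; split=> //; lia.
- have [|i' lti' e] := rcov (if c == 3 then n - i else i.+1)%N; first by case: ifP; lia.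
  have [lti2 e2] := cK' _ hb _ lti'.
  case: c34 e => -> /=; have [hp|hp] := lerP 0 (r i') => e.
  + by exists 4, (cadd n i' b); rewrite /= e2 /half_block; split=> //; lia.
  + by exists 3, i'; rewrite /= /half_block; split=> //; lia.
  + by exists 3, i'; rewrite /= /half_block; split=> //; lia.
  + by exists 4, (cadd n i' b); rewrite /= e2 /half_block; split=> //; lia.
Qed.

(** * Case k = 0 modulo 4 *)

Lemma heffter_k0mod4 (n q : nat) : (0 < q)%N -> (4 * q <= n)%N ->
  exists A : pf_array 'Z_(heffter_modulus n (4 * q) (4 * q)) n, integer_relative_heffter A.
Proof.
move=> q_gt0 qn.
(* The base filling has no diagonals; the shift 2 takes the pair c, c + 1 to c + 2, c + 3. *)
apply: (@heffter_circulant n 0 q id (fun _ _ => 0)); rewrite ?add0n; try lia.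
- by move=> r ltr; exists 2; rewrite /cadd /=; [lia | split; case: ifP; lia].
- by split=> // *; rewrite big_ord0.
Qed.

(** * Case k = 3 modulo 4 *)

Lemma heffter_three_diagonals (n q : nat) y d : (2 < n)%N -> (3 + 4 * q <= n)%N ->
  (forall c i, (c < 3)%N -> (i < n)%N -> exists2 i', (i' < n)%N &
     [\/ `|y i'|%N = half_block n c i, `|(y i' - d)%R|%N = half_block n c i
       | `|(y i' + y (csub n i' 1) - d)%R|%N = half_block n c i]) ->
  exists A : pf_array 'Z_(heffter_modulus n (3 + 4 * q) (3 + 4 * q)) n,
    integer_relative_heffter A.
Proof.
move=> n_gt2 qn /(filling_three_diagonals n_gt2) fil.
apply: (@heffter_circulant n 3 q id (three_diagonals n y d)) => //; try lia.
by move=> r ltr; exists 2; rewrite /cadd /=; [lia | split; case: ifP; lia].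
Qed.

(* Half of the entries come from two zigzags (3m+1, m-1, 3m+2, .., 1, n) and
   (m, 3m-1, m+1, .., 2m-1), which together run through the consecutive
   differences 2, .., n-1 except 2m and 2m+1; they are joined by the two
   exceptional values y 0 = 1 and y (2m) = 2m. *)
Definition y3_n0mod4 (m i : nat) : int :=
  let s := i./2%:Z in
  if odd i then (if (i./2 < m)%N then - (7 * m%:Z + 1 + s) else 8 * m%:Z + 1 + s)
  else if i == 0%N then 1 else if (i./2 < m)%N then 9 * m%:Z + 1 - s
  else if i./2 == m then 2 * m%:Z else s - 8 * m%:Z.

Lemma heffter_k3mod4_n0mod4 (m q : nat) : (0 < m)%N -> (3 + 4 * q <= 4 * m)%N ->
  exists A : pf_array 'Z_(heffter_modulus (4 * m) (3 + 4 * q) (3 + 4 * q)) (4 * m),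
    integer_relative_heffter A.
Proof.
(* A zigzag label u < 2m stands for the value 8m + 1 + u, a label v > 2m for -(4m + v). With d = 4m
   + 1, two adjacent labels then put their difference u - v, up to sign, on diagonal 1. *)
move=> m_gt0 qm; apply: (@heffter_three_diagonals _ _ (y3_n0mod4 m) (4 * m).+1%:Z) => //; first by lia.
move=> c i ltc lti.
pose a := half_block (4 * m) c i; rewrite -/a.
have Y i' : (i' < 4 * m)%N -> `|y3_n0mod4 m i'|%N = a -> exists2 i', (i' < 4 * m)%N &
     [\/ `|y3_n0mod4 m i'|%N = a, `|(y3_n0mod4 m i' - (4 * m).+1%:Z)%R|%N = a
       | `|(y3_n0mod4 m i' + y3_n0mod4 m (csub (4 * m) i' 1) - (4 * m).+1%:Z)%R|%N = a].
  by move=> lti' e; exists i' => //; constructor 1.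
have Z i' : (i' < 4 * m)%N -> `|(y3_n0mod4 m i' - (4 * m).+1%:Z)%R|%N = a ->
     exists2 i', (i' < 4 * m)%N &
     [\/ `|y3_n0mod4 m i'|%N = a, `|(y3_n0mod4 m i' - (4 * m).+1%:Z)%R|%N = a
       | `|(y3_n0mod4 m i' + y3_n0mod4 m (csub (4 * m) i' 1) - (4 * m).+1%:Z)%R|%N = a].
  by move=> lti' e; exists i' => //; constructor 2.
have X i' : (i' < 4 * m)%N ->
     `|(y3_n0mod4 m i' + y3_n0mod4 m (csub (4 * m) i' 1) - (4 * m).+1%:Z)%R|%N = a ->
     exists2 i', (i' < 4 * m)%N &
     [\/ `|y3_n0mod4 m i'|%N = a, `|(y3_n0mod4 m i' - (4 * m).+1%:Z)%R|%N = a
       | `|(y3_n0mod4 m i' + y3_n0mod4 m (csub (4 * m) i' 1) - (4 * m).+1%:Z)%R|%N = a].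
  by move=> lti' e; exists i' => //; constructor 3.
have yE s : y3_n0mod4 m (2 * s) = if s == 0%N then 1 else
    if (s < m)%N then 9 * m%:Z + 1 - s%:Z else if s == m then 2 * m%:Z else s%:Z - 8 * m%:Z.
  by rewrite /y3_n0mod4; do !case: ifP; lia.
have yO s : y3_n0mod4 m (2 * s).+1 =
    if (s < m)%N then - (7 * m%:Z + 1 + s%:Z) else 8 * m%:Z + 1 + s%:Z.
  by rewrite /y3_n0mod4; do !case: ifP; lia.
have xO s : csub (4 * m) (2 * s).+1 1 = (2 * s)%N by rewrite csub_ge; lia.
have xE s : csub (4 * m) (2 * s.+1) 1 = (2 * s).+1 by rewrite csub_ge; lia.
have x0 : csub (4 * m) (2 * 0) 1 = (2 * (2 * m).-1).+1 by rewrite csub_lt; lia.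
have aE : a = (4 * m * c + c./2 + i).+1 by rewrite /a /half_block; lia.
have [c0|[c1|c2]] : c = 0%N \/ c = 1%N \/ c = 2 by lia.
(* The values 1, 2m, 2m + 1 and n, which are not zigzag differences, come from [y 0], [y (2m)] and
   these minus d. *)
- rewrite c0 in aE.
  have [a1|a1] := eqVneq a 1%N; first by apply: (Y (2 * 0)%N); rewrite ?yE; if_lia.
  have [a2|a2] := eqVneq a (2 * m)%N; first by apply: (Y (2 * m)%N); rewrite ?yE; if_lia.
  have [a3|a3] := eqVneq a (2 * m).+1; first by apply: (Z (2 * m)%N); rewrite ?yE; if_lia.
  have [a4|a4] := eqVneq a (4 * m)%N; first by apply: (Z (2 * 0)%N); rewrite ?yE; if_lia.
  have [a5|a5] := ltnP a (2 * m); have := odd_double_half a; case: (odd a) => ae.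
  + apply: (X (2 * (2 * m - a./2).-1.+1)%N); [lia | rewrite xE yE yO; if_lia].
  + apply: (X (2 * (2 * m - a./2)).+1%N); [lia | rewrite xO yE yO; if_lia].
  + apply: (X (2 * (a./2 - m)).+1%N); [lia | rewrite xO yE yO; if_lia].
  + apply: (X (2 * (a./2 - m).-1.+1)%N); [lia | rewrite xE yE yO; if_lia].
- rewrite c1 in aE.
  have [a1|a1] := ltnP a (5 * m); first by apply: (Z (2 * (5 * m - a))%N); rewrite ?yE; if_lia.
  have [a2|a2] := ltnP a (6 * m); first by apply: (Z (2 * (a - 4 * m)).+1%N); rewrite ?yO; if_lia.
  (* The zigzags skip the labels 2m and 3m. The corresponding values 6m, 10m + 1, 7m, 11m + 1 arise
     on diagonal 1 from the sums that involve [y 0] or [y (2m)]. *)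
  have [a3|a3] := eqVneq a (6 * m)%N.
    by apply: (X (2 * 0)%N); [lia | rewrite x0 yE yO /=; if_lia].
  have [a4|a4] := ltnP a (7 * m); first by apply: (Y (2 * (8 * m - a))%N); rewrite ?yE; if_lia.
  have [a5|a5] := eqVneq a (7 * m)%N.
    by apply: (X (2 * m).+1%N); [lia | rewrite xO yE yO; if_lia].
  by apply: (Y (2 * (a - 7 * m - 1)).+1%N); rewrite ?yO; if_lia.
rewrite c2 in aE.
have [a1|a1] := leqP a (9 * m); first by apply: (Y (2 * (9 * m + 1 - a))%N); rewrite ?yE; if_lia.
have [a2|a2] := leqP a (10 * m); first by apply: (Y (2 * (a - 8 * m - 1)).+1%N); rewrite ?yO; if_lia.
have [a3|a3] := eqVneq a (10 * m).+1.
  by apply: (X (2 * m.-1.+1)%N); [lia | rewrite xE yE yO; if_lia].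
have [a4|a4] := leqP a (11 * m); first by apply: (Z (2 * (12 * m + 1 - a))%N); rewrite ?yE; if_lia.
have [a5|a5] := eqVneq a (11 * m).+1.
  by apply: (X (2 * 0).+1%N); [lia | rewrite xO yE yO; if_lia].
by apply: (Z (2 * (a - 11 * m - 2)).+1%N); rewrite ?yO; if_lia.
Qed.

(* A graceful labelling of the path by two zigzags, m+1, 3m+3, m, .., 1, n and
   2m+2, 2m+1, .., m+2, 3m+2, with alternating signs; the ends add up to n, the
   only value that is not a difference of two labels. *)
Definition v3_n3mod4 (m i : nat) : int :=
  let s := i./2%:Z in
  if odd i then (if (i./2 <= m)%N then - (3 * m%:Z + 3 + s) else s - 3 * m%:Z - 2)
  else if (i./2 <= m)%N then m%:Z + 1 - s else m%:Z + 1 + s.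

(** With y = M + v and d = 2M the diagonals hold v - M, M + v and, up to sign, v i + v (i-1). So |v|
    must cover 1, .., n for runs 1 and 2, and the cyclic sums must do so for run 0. *)
Lemma heffter_k3mod4_n3mod4 (m q : nat) : (3 + 4 * q <= 4 * m + 3)%N ->
  exists A : pf_array 'Z_(heffter_modulus (4 * m + 3) (3 + 4 * q) (3 + 4 * q)) (4 * m + 3),
    integer_relative_heffter A.
Proof.
move=> qm; set n := (4 * m + 3)%N; pose M := (2 * n).+1%:Z.
have vE s : v3_n3mod4 m (2 * s) = if (s <= m)%N then m%:Z + 1 - s%:Z else m%:Z + 1 + s%:Z.
  by rewrite /v3_n3mod4; if_lia.
have vO s : v3_n3mod4 m (2 * s).+1 =
    if (s <= m)%N then - (3 * m%:Z + 3 + s%:Z) else s%:Z - 3 * m%:Z - 2.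
  by rewrite /v3_n3mod4; if_lia.
have xO s : csub n (2 * s).+1 1 = (2 * s)%N by rewrite csub_ge; lia.
have xE s : csub n (2 * s.+1) 1 = (2 * s).+1 by rewrite csub_ge; lia.
have x0 : csub n (2 * 0) 1 = (2 * (2 * m).+1)%N by rewrite csub_lt; lia.
have vcov a : (0 < a <= n)%N -> exists2 i, (i < n)%N & `|v3_n3mod4 m i|%N = a.
  move=> ha.
  have [h1|h1] := leqP a m.+1; first by exists (2 * (m + 1 - a))%N; rewrite ?vE; if_lia.
  have [h2|h2] := leqP a (2 * m + 1); first by exists (2 * (3 * m + 2 - a)).+1%N; rewrite ?vO; if_lia.
  have [h3|h3] := leqP a (3 * m + 2); first by exists (2 * (a - m - 1))%N; rewrite ?vE; if_lia.
  by exists (2 * (a - 3 * m - 3)).+1%N; rewrite ?vO; if_lia.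
have scov a : (0 < a <= n)%N -> exists2 i, (i < n)%N &
    `|(v3_n3mod4 m i + v3_n3mod4 m (csub n i 1))%R|%N = a.
  move=> ha; have := odd_double_half a.
  (* Closing the cycle gives n; the junction of the two zigzags gives 2m + 1. *)
  have [h1|h1] := eqVneq a n.
    by exists (2 * 0)%N; rewrite ?x0 ?vE; if_lia.
  have [h2|h2] := eqVneq a (2 * m + 1)%N.
    by exists (2 * m.+1)%N; rewrite ?xE ?vE ?vO; if_lia.
  have [h3|h3] := ltnP a (2 * m + 1); case: (odd a) => ae.
  - by exists (2 * (a./2 + m + 1)).+1%N; rewrite ?xO ?vE ?vO; if_lia.
  - by exists (2 * (a./2 + m).+1)%N; rewrite ?xE ?vE ?vO; if_lia.
  - by exists (2 * (a./2 - m).-1.+1)%N; rewrite ?xE ?vE ?vO; if_lia.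
  - by exists (2 * (a./2 - m - 1)).+1%N; rewrite ?xO ?vE ?vO; if_lia.
apply: (@heffter_three_diagonals _ _ (fun i => M + v3_n3mod4 m i) (2 * M)); try lia.
move=> c i ltc lti; rewrite /half_block.
have : c = 0%N \/ c = 1%N \/ c = 2 by lia.
case=> [->|c12].
  have [|i' lti' e] := scov i.+1; first by lia.
  by exists i' => //; constructor 3; lia.
have [|i' lti' e] := vcov (if c == 1%N then n - i else i.+1)%N; first by if_lia.
exists i' => //; case: c12 e => -> /=; have [hp|hp] := lerP 0 (v3_n3mod4 m i') => e.
- by constructor 2; lia.
- by constructor 1; lia.
- by constructor 1; lia.
- by constructor 2; lia.
Qed.

(** * Case k = 1 modulo 4 *)

(* After the five initial diagonals, the pairs of offsets (2+2q, 3+2q) are matched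
   with the pairs at distance max(b, n-b) - 1 beyond them. *)
Definition five_offsets (n b c : nat) : nat :=
  match c with
  | 0 => 0%N | 1 => 1%N | 2 => n.-1 | 3 => b | 4 => (n - b)%N
  | c'.+4 => let q := (c'.-1 %/ 4)%N in
    match (c'.-1 %% 4)%N with
    | 0 => (2 + 2 * q)%N | 1 => (3 + 2 * q)%N
    | 2 => (maxn b (n - b)).+1 + 2 * q | _ => (maxn b (n - b)).+2 + 2 * q end
  end.

(** As b and n - b lie next to n/2, the offsets 2, 3, .. fit below both of them and their translates
    fit between the larger one and n - 1. *)
Lemma heffter_five_diagonals (n b q : nat) (p r : nat -> int) :
  (5 + 4 * q <= n)%N -> (b = (n./2).+1 /\ ~~ odd n \/ b = n./2 /\ odd n) ->
  (2 * q < n./2 - 1)%N ->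
  (forall a, (0 < a <= n)%N -> exists2 i, (i < n)%N & `|p i|%N = a) ->
  (forall a, (0 < a <= n)%N -> exists2 i, (i < n)%N & `|r i|%N = a) ->
  (forall a, (0 < a <= n)%N -> exists2 i, (i < n)%N &
     `|(p i + p (csub n i 1) + r i + r (csub n i b))%R|%N = a) ->
  exists A : pf_array 'Z_(heffter_modulus n (5 + 4 * q) (5 + 4 * q)) n,
    integer_relative_heffter A.
Proof.
move=> qn hb qm pcov rcov ecov.
have offE s : [/\ five_offsets n b (5 + 4 * s) = (2 + 2 * s)%N,
    five_offsets n b (5 + 4 * s).+1 = (3 + 2 * s)%N,
    five_offsets n b (5 + 4 * s).+2 = ((maxn b (n - b)).+1 + 2 * s)%N &
    five_offsets n b (5 + 4 * s).+3 = ((maxn b (n - b)).+2 + 2 * s)%N].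
  rewrite /five_offsets /=.
  have -> : ((4 * s) %/ 4 = s)%N by lia. have -> : ((4 * s) %% 4 = 0)%N by lia.
  have -> : ((4 * s).+1 %/ 4 = s)%N by lia. have -> : ((4 * s).+1 %% 4 = 1)%N by lia.
  have -> : ((4 * s).+2 %/ 4 = s)%N by lia. have -> : ((4 * s).+2 %% 4 = 2)%N by lia.
  have -> : ((4 * s).+3 %/ 4 = s)%N by lia. have -> : ((4 * s).+3 %% 4 = 3)%N by lia.
  by [].
have casesP c : (c < 5 + 4 * q)%N ->
    (c = 0%N /\ five_offsets n b c = 0%N) \/ (c = 1%N /\ five_offsets n b c = 1%N)
    \/ (c = 2 /\ five_offsets n b c = n.-1) \/ (c = 3 /\ five_offsets n b c = b)
    \/ (c = 4 /\ five_offsets n b c = (n - b)%N) \/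
    exists2 s, (s < q)%N & (c = (5 + 4 * s)%N /\ five_offsets n b c = (2 + 2 * s)%N)
    \/ (c = (5 + 4 * s).+1%N /\ five_offsets n b c = (3 + 2 * s)%N)
    \/ (c = (5 + 4 * s).+2%N /\ five_offsets n b c = ((maxn b (n - b)).+1 + 2 * s)%N)
    \/ (c = (5 + 4 * s).+3%N /\ five_offsets n b c = ((maxn b (n - b)).+2 + 2 * s)%N).
  have [|le5c] := ltnP c 5; first by case: c => [|[|[|[|[|c]]]]] //= _ _; tauto.
  move=> ltc; do 5!right; exists ((c - 5) %/ 4)%N; first by lia.
  have [] := offE ((c - 5) %/ 4)%N; set s := ((c - 5) %/ 4)%N => h0 h1 h2 h3.
  have : c = (5 + 4 * s)%N \/ c = (5 + 4 * s).+1%N \/ c = (5 + 4 * s).+2%N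
      \/ c = (5 + 4 * s).+3%N by rewrite /s; lia.
  by case=> [|[|[|]]] ->; rewrite ?h0 ?h1 ?h2 ?h3; tauto.
apply: (@heffter_circulant n 5 q (five_offsets n b) (five_diagonals n b p r)); try lia.
- by move=> c /casesP; case=> [|[|[|[|[|[s lts]]]]]]; lia.
- move=> c c' /casesP hc /casesP hc'.
  by case: hc => [|[|[|[|[|[s lts]]]]]]; case: hc' => [|[|[|[|[|[s' lts']]]]]]; lia.
- move=> s lts; have [e0 e1 e2 e3] := offE s.
  exists (maxn b (n - b)).-1; first by lia.
  by cbv zeta; rewrite e0 e1 e2 e3 /cadd; split; if_lia.
- by apply: filling_five_diagonals => //; lia.
Qed.

(* The zigzags n, -1, n-1, -2, .., 3m+1 and m, -3m, m+1, .., 2m. *)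
Definition p5_n0mod4 (m i : nat) : int :=
  let s := i./2%:Z in
  if odd i then (if (i./2.+1 < m)%N then - (s + 1) else s + 1)
  else if (i./2 < m)%N then 4 * m%:Z - s else s - 4 * m%:Z.

(* With b = 2m+1 this is r (j b) = (-1)^j (j + 1), so that r i + r (i - b) is
   (-1)^i, except that it is 1 - n for i = 0. *)
Definition r5_n0mod4 (m i : nat) : int :=
  let s := i./2%:Z in
  if odd i then (if (i./2 < m)%N then - (2 * s + 2 * m%:Z + 2) else 2 * m%:Z - 2 * s - 2)
  else 2 * s + 1.

Lemma heffter_k1mod4_n0mod4 (m q : nat) : (5 + 4 * q <= 4 * m)%N ->
  exists A : pf_array 'Z_(heffter_modulus (4 * m) (5 + 4 * q) (5 + 4 * q)) (4 * m),
    integer_relative_heffter A.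
Proof.
move=> qm; set n := (4 * m)%N.
have pE s : p5_n0mod4 m (2 * s) = if (s < m)%N then 4 * m%:Z - s%:Z else s%:Z - 4 * m%:Z.
  by rewrite /p5_n0mod4; if_lia.
have pO s : p5_n0mod4 m (2 * s).+1 = if (s.+1 < m)%N then - (s%:Z + 1) else s%:Z + 1.
  by rewrite /p5_n0mod4; if_lia.
have rE s : r5_n0mod4 m (2 * s) = 2 * s%:Z + 1 by rewrite /r5_n0mod4; if_lia.
have rO s : r5_n0mod4 m (2 * s).+1 =
    if (s < m)%N then - (2 * s%:Z + 2 * m%:Z + 2) else 2 * m%:Z - 2 * s%:Z - 2.
  by rewrite /r5_n0mod4; if_lia.
apply: (@heffter_five_diagonals _ (2 * m).+1 _ (p5_n0mod4 m) (r5_n0mod4 m)); try lia.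
- move=> a ha; have [h|h] := leqP a (2 * m).
    by exists (2 * a.-1).+1; rewrite ?pO; if_lia.
  by exists (2 * (4 * m - a))%N; rewrite ?pE; if_lia.
- move=> a ha; have := odd_double_half a; case: (odd a) => ae.
    by exists (2 * a./2)%N; rewrite ?rE; if_lia.
  have [h|h] := leqP a (2 * m).
    by exists (2 * (a./2 + m - 1)).+1; rewrite ?rO; if_lia.
  by exists (2 * (a./2 - m - 1)).+1; rewrite ?rO; if_lia.
have c1O s : csub n (2 * s).+1 1 = (2 * s)%N by rewrite csub_ge; lia.
have c1E s : csub n (2 * s.+1) 1 = (2 * s).+1 by rewrite csub_ge; lia.
have rrO s : (s < 2 * m)%N -> r5_n0mod4 m (2 * s).+1 + r5_n0mod4 m (csub n (2 * s).+1 (2 * m).+1) = -1.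
  move=> lts; have [h|h] := ltnP s m.
    rewrite csub_lt; last by lia.
    by rewrite (_ : _ - _ = 2 * (s + m))%N ?rO ?rE; if_lia.
  rewrite csub_ge; last by lia.
  by rewrite (_ : _ - _ = 2 * (s - m))%N ?rO ?rE; if_lia.
have rrE s : (s.+1 < 2 * m)%N ->
    r5_n0mod4 m (2 * s.+1) + r5_n0mod4 m (csub n (2 * s.+1) (2 * m).+1) = 1.
  move=> lts; have [h|h] := ltnP s m.
    rewrite csub_lt; last by lia.
    by rewrite (_ : _ - _ = (2 * (s + m)).+1)%N ?rO ?rE; if_lia.
  rewrite csub_ge; last by lia.
  by rewrite (_ : _ - _ = (2 * (s - m)).+1)%N ?rO ?rE; if_lia.
have E s : (s.+1 < 2 * m)%N -> exists2 i, (i < n)%N &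
    `|(p5_n0mod4 m i + p5_n0mod4 m (csub n i 1) + r5_n0mod4 m i + r5_n0mod4 m (csub n i (2 * m).+1))%R|%N =
    `|(p5_n0mod4 m (2 * s.+1) + p5_n0mod4 m (2 * s).+1 + 1)%R|%N.
  by move=> lts; exists (2 * s.+1)%N; [lia | rewrite -addrA rrE // c1E].
have O s : (s < 2 * m)%N -> exists2 i, (i < n)%N &
    `|(p5_n0mod4 m i + p5_n0mod4 m (csub n i 1) + r5_n0mod4 m i + r5_n0mod4 m (csub n i (2 * m).+1))%R|%N =
    `|(p5_n0mod4 m (2 * s).+1 + p5_n0mod4 m (2 * s) - 1)%R|%N.
  by move=> lts; exists (2 * s).+1%N; [lia | rewrite -addrA rrO // c1O].
move=> a ha.
(* The alternating correction swaps neighbouring zigzag sums in pairs, giving the absolute values 2m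
   + 2, .., n - 1 and 1, .., 2m. Cell 0 supplies 2m + 1, and the junction 3m + 1, m supplies n. *)
have [h0|h0] := eqVneq a (2 * m).+1.
  exists (2 * 0)%N; first by lia.
  rewrite !csub_lt; [|lia..].
  rewrite (_ : 2 * 0 + n - 1 = (2 * (2 * m).-1).+1)%N; last by lia.
  rewrite (_ : 2 * 0 + n - _ = (2 * m.-1).+1)%N; last by lia.
  by rewrite !rE rO pE pO; if_lia.
have [h1|h1] := eqVneq a (4 * m)%N.
  have [|i lti e] := O m.-1; first by lia.
  by exists i => //; rewrite e pE pO; if_lia.
have := odd_double_half a; have [h|h] := leqP a (2 * m); case: (odd a) => ae.
- have [|i lti e] := E (2 * m - 1 - a./2).-1; first by lia.
  by exists i => //; rewrite e pE pO; if_lia.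
- have [|i lti e] := O (2 * m - a./2)%N; first by lia.
  by exists i => //; rewrite e pE pO; if_lia.
- have [|i lti e] := E (2 * m - a./2).-1; first by lia.
  by exists i => //; rewrite e pE pO; if_lia.
- have [|i lti e] := O (2 * m - a./2).-1; first by lia.
  by exists i => //; rewrite e pE pO; if_lia.
Qed.

(* The zigzags n, -1, n-1, -2, .., 3m+3 and -(3m+2), m+1, .., -(2m+2), followed by
   -(2m+1). *)
Definition p5_n3mod4 (m i : nat) : int :=
  let s := i./2%:Z in
  if odd i then (if (i./2 < m)%N then - (s + 1) else s - 4 * m%:Z - 2)
  else if (i./2 <= m)%N then 4 * m%:Z + 3 - s
  else if (i./2 <= 2 * m)%N then s else - s.

(* With b = 2m+1 this is r (b + j b) = -(-1)^j (j + 1), so that r i + r (i - b) is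
   -1 for i <= 2m and 1 for i > 2m+1. *)
Definition r5_n3mod4 (m i : nat) : int :=
  if (i <= (2 * m).+1)%N then 2 * i%:Z - 4 * m%:Z - 3 else 8 * m%:Z + 6 - 2 * i%:Z.

Lemma heffter_k1mod4_n3mod4 (m q : nat) : (5 + 4 * q <= 4 * m + 3)%N ->
  exists A : pf_array 'Z_(heffter_modulus (4 * m + 3) (5 + 4 * q) (5 + 4 * q)) (4 * m + 3),
    integer_relative_heffter A.
Proof.
move=> qm; set n := (4 * m + 3)%N.
have pE s : p5_n3mod4 m (2 * s) = if (s <= m)%N then 4 * m%:Z + 3 - s%:Z
    else if (s <= 2 * m)%N then s%:Z else - s%:Z.
  by rewrite /p5_n3mod4; if_lia.
have pO s : p5_n3mod4 m (2 * s).+1 =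
    if (s < m)%N then - (s%:Z + 1) else s%:Z - 4 * m%:Z - 2.
  by rewrite /p5_n3mod4; if_lia.
have rr i : (i < n)%N -> r5_n3mod4 m i + r5_n3mod4 m (csub n i (2 * m).+1) =
    if (i <= 2 * m)%N then -1 else if i == (2 * m).+1 then - n.+1%:Z else 1.
  by move=> lti; rewrite /csub; case: (leqP (2 * m).+1 i) => h; rewrite /r5_n3mod4; if_lia.
apply: (@heffter_five_diagonals _ (2 * m).+1 _ (p5_n3mod4 m) (r5_n3mod4 m)); try lia.
- move=> a ha.
  have [h1|h1] := leqP a m; first by exists (2 * a.-1).+1; rewrite ?pO; if_lia.
  have [h2|h2] := leqP a (2 * m + 1); first by exists (2 * a)%N; rewrite ?pE; if_lia.
  have [h3|h3] := leqP a (3 * m + 2).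
    by exists (2 * (4 * m + 2 - a)).+1; rewrite ?pO; if_lia.
  by exists (2 * (4 * m + 3 - a))%N; rewrite ?pE; if_lia.
- move=> a ha; have := odd_double_half a; case: (odd a) => ae.
    by exists (2 * m + 1 - a./2)%N; rewrite /r5_n3mod4; if_lia.
  by exists (4 * m + 3 - a./2)%N; rewrite /r5_n3mod4; if_lia.
have c1O s : csub n (2 * s).+1 1 = (2 * s)%N by rewrite csub_ge; lia.
have c1E s : csub n (2 * s.+1) 1 = (2 * s).+1 by rewrite csub_ge; lia.
have ee i : (i < n)%N ->
    p5_n3mod4 m i + p5_n3mod4 m (csub n i 1) + r5_n3mod4 m i + r5_n3mod4 m (csub n i (2 * m).+1) =
    p5_n3mod4 m i + p5_n3mod4 m (csub n i 1) +
    (if (i <= 2 * m)%N then -1 else if i == (2 * m).+1 then - n.+1%:Z else 1).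
  by move=> lti; rewrite -addrA rr.
move=> a ha.
(* The corrected zigzag sums run through 4m + 1, .., 2m + 2 and -2m, .., -1. The rows 0, 2m + 1 and
   4m + 2 supply the remaining 2m + 1, n and n - 1. *)
have [h0|h0] := eqVneq a (2 * m).+1.
  exists (2 * 0)%N; [by lia | rewrite ee; last by lia].
  by rewrite csub_lt // (_ : _ - 1 = 2 * (2 * m).+1)%N ?pE; if_lia.
have [h1|h1] := eqVneq a n.
  exists (2 * m).+1; [by lia | rewrite ee; last by lia].
  by rewrite c1O pE pO; if_lia.
have [h2|h2] := eqVneq a n.-1.
  exists (2 * (2 * m).+1)%N; [by lia | rewrite ee; last by lia].
  by rewrite c1E pE pO; if_lia.
have := odd_double_half a; case: (odd a) => ae.
  exists (2 * (2 * m - a./2)).+1; [by lia | rewrite ee; last by lia].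
  by rewrite c1O pE pO; if_lia.
exists (2 * (2 * m - a./2).+1)%N; [by lia | rewrite ee; last by lia].
by rewrite c1E pE pO; if_lia.
Qed.

(** * Case k = 2 modulo 4 *)

Definition flip (i : nat) : nat := if odd i then i.-1 else i.+1.

Lemma flipK : involutive flip.
Proof. by move=> i; rewrite /flip; case: (boolP (odd i)) => /= hi; if_lia. Qed.

(* Pairs {2I, 2I+1} of rows and of columns cut the array into 2 x 2 blocks;
   indices 2d and 2d+1 are the two diagonals of the blocks (I, I + d). *)
Definition block_col (n c i : nat) : nat :=
  cadd n (if odd c then flip i else i) c./2.*2.
Definition block_row (n c j : nat) : nat :=
  let i := csub n j c./2.*2 in if odd c then flip i else i.

Lemma block_layout (n k : nat) : ~~ odd n -> (k <= n)%N ->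
  layout n k (block_col n) (block_row n).
Proof.
move=> n_even kn.
have flip_lt i : (i < n)%N -> (flip i < n)%N by rewrite /flip; if_lia.
have caddK i d : (i < n)%N -> (d < n)%N -> (cadd n i d < n)%N /\ csub n (cadd n i d) d = i.
  by move=> lti ltd; rewrite /cadd /csub; do !case: ifP; lia.
have csubK j d : (j < n)%N -> (d < n)%N -> (csub n j d < n)%N /\ cadd n (csub n j d) d = j.
  by move=> ltj ltd; rewrite /cadd /csub; do !case: ifP; lia.
have half_lt c : (c < k)%N -> (c./2.*2 < n)%N by lia.
split=> [c i ltc lti|c j ltc ltj|c c' i ltc ltc' lti].
- have lti' : ((if odd c then flip i else i) < n)%N by case: ifP; auto.
  rewrite /block_col /block_row; have [lt ->] := caddK _ _ lti' (half_lt c ltc).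
  by split=> //; case: (odd c); rewrite ?flipK.
- rewrite /block_col /block_row; have [lt e] := csubK _ _ ltj (half_lt c ltc).
  by split; case: (odd c); rewrite ?flipK //; apply: flip_lt.
have := half_lt c ltc; have := half_lt c' ltc'.
rewrite /block_col /cadd /flip; case: (boolP (odd i)) => oi;
  case: (boolP (odd c)) => oc; case: (boolP (odd c')) => oc'; do !case: ifP; lia.
Qed.

(* In each block the signs alternate along rows and columns, so the common term t
   of its four entries cancels in all lines, wherever the blocks are placed. *)
Definition block_entry (n c i : nat) : int :=
  let M := (2 * n).+1%:Z in let t := 4 * i./2%:Z in
  if odd i then
    match c with
    | 0 => - (2 * M + t + 4) | 1 => 2 * M + t + 2 | 2 => M + t + 2
    | 3 => - (M + t + 1) | 4 => M + t + 4 | _ => - (M + t + 3) end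
  else
    match c with
    | 0 => - (t + 2) | 1 => 2 * M + t + 3 | 2 => t + 1
    | 3 => - (t + 4) | 4 => t + 3 | _ => - (2 * M + t + 1) end.

Lemma filling_block (n : nat) : ~~ odd n -> (6 <= n)%N ->
  filling n 6 (block_row n) (block_entry n).
Proof.
move=> n_even n_ge6; split=> [i lti|j ltj|c i ltc lti].
- by rewrite !big_ord_recr big_ord0 /block_entry /=; case: (odd i); lia.
- rewrite !big_ord_recr big_ord0 /= /block_row /=.
  have parity d : ~~ odd d -> (d < n)%N -> odd (csub n j d) = odd j.
    by move=> hd ltd; rewrite /csub; if_lia.
  have := parity 0%N; have := parity 2; have := parity 4.
  move: (csub n j 0) (csub n j 2) (csub n j 4) => i0 i2 i4 /(_ isT) h4 /(_ isT) h2 /(_ isT) h0.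
  have {h4} h4 := h4 ltac:(lia); have {h2} h2 := h2 ltac:(lia); have {h0} h0 := h0 ltac:(lia).
  rewrite /block_entry /flip h0 h2 h4; move: h0 h2 h4; case: (odd j) => h0 h2 h4 /=.
    by do ![rewrite ifF; last by lia]; lia.
  by do ![rewrite ifT; last by lia]; lia.
(* Runs 2h and 2h + 1 together are hM + 1, .., hM + 2n. As n is even they split into quadruples hM +
   4I + 1, .., hM + 4I + 4, and row pair I takes the I-th one for h = 0, 1, 2. *)
pose x := (odd c * n + i)%N; pose I := (x %/ 4)%N.
have hx : x = (4 * I + x %% 4)%N by rewrite /I; lia.
have lt4 : (x %% 4 < 4)%N by rewrite ltn_mod.
have ltI : (2 * I + 1 < n)%N by rewrite /I /x; case: (odd c); lia.
have bE c' : block_entry n c' (2 * I) = let M := (2 * n).+1%:Z in let t := 4 * I%:Z in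
    match c' with
    | 0 => - (t + 2) | 1 => 2 * M + t + 3 | 2 => t + 1
    | 3 => - (t + 4) | 4 => t + 3 | _ => - (2 * M + t + 1) end.
  by rewrite /block_entry mul2n odd_double doubleK.
have bO c' : block_entry n c' (2 * I).+1 = let M := (2 * n).+1%:Z in let t := 4 * I%:Z in
    match c' with
    | 0 => - (2 * M + t + 4) | 1 => 2 * M + t + 2 | 2 => M + t + 2
    | 3 => - (M + t + 1) | 4 => M + t + 4 | _ => - (M + t + 3) end.
  by rewrite /block_entry mul2n /= odd_double uphalf_double.
have hbE : half_block n c i = (c./2 * (2 * n).+1 + x).+1.
  by rewrite /half_block /x -{1}(odd_double_half c); case: (odd c); lia.
have E c' : (c' < 6)%N -> `|block_entry n c' (2 * I)|%N = half_block n c i ->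
    exists c' i', [/\ (c' < 6)%N, (i' < n)%N & `|block_entry n c' i'|%N = half_block n c i].
  by move=> ltc' e; exists c', (2 * I)%N; split=> //; lia.
have O c' : (c' < 6)%N -> `|block_entry n c' (2 * I).+1|%N = half_block n c i ->
    exists c' i', [/\ (c' < 6)%N, (i' < n)%N & `|block_entry n c' i'|%N = half_block n c i].
  by move=> ltc' e; exists c', (2 * I).+1; split=> //; lia.
have : (c./2 = 0 \/ c./2 = 1 \/ c./2 = 2)%N by lia.
move: (x %% 4)%N lt4 hx => r lt4 hx.
have hr : (r = 0 \/ r = 1 \/ r = 2 \/ r = 3)%N by lia.
case=> [h|[h|h]]; rewrite h in hbE; case: hr => [hr|[hr|[hr|hr]]]; rewrite hr in hx.
- by apply: (E 2) => //; rewrite bE hbE /=; lia.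
- by apply: (E 0%N) => //; rewrite bE hbE /=; lia.
- by apply: (E 4) => //; rewrite bE hbE /=; lia.
- by apply: (E 3) => //; rewrite bE hbE /=; lia.
- by apply: (O 3) => //; rewrite bO hbE /=; lia.
- by apply: (O 2) => //; rewrite bO hbE /=; lia.
- by apply: (O 5) => //; rewrite bO hbE /=; lia.
- by apply: (O 4) => //; rewrite bO hbE /=; lia.
- by apply: (E 5) => //; rewrite bE hbE /=; lia.
- by apply: (O 1%N) => //; rewrite bO hbE /=; lia.
- by apply: (E 1%N) => //; rewrite bE hbE /=; lia.
- by apply: (O 0%N) => //; rewrite bO hbE /=; lia.
Qed.

(** Here [tau] is the identity: flip i - i depends only on the parity of i, which even shifts modulo
    an even n preserve, so the two blocks of a quadruple cancel in each column. *)
Lemma heffter_k2mod4 (n q : nat) : ~~ odd n -> (6 + 4 * q <= n)%N ->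
  exists A : pf_array 'Z_(heffter_modulus n (6 + 4 * q) (6 + 4 * q)) n,
    integer_relative_heffter A.
Proof.
move=> n_even qn; have n_ge6 : (6 <= n)%N by lia.
have [r ltr|w filw] := filling_iter (filling_block n_even n_ge6) (q := q).
  exists id => [i lti|c j ltj]; first by exists i.
  have [h0 h1] : odd c = false /\ odd c.+2 = false by rewrite /c; lia.
  have [h2 h3] : odd c.+1 /\ odd c.+3 by rewrite /c; lia.
  have [e1 e3] : c.+1./2.*2 = c./2.*2 /\ c.+3./2.*2 = c.+2./2.*2 by lia.
  rewrite /block_row h0 h1 h2 h3 e1 e3.
  have par d : (d.*2 < n)%N -> odd (csub n j d.*2) = odd j by rewrite /csub; if_lia.
  have : odd (csub n j c./2.*2) = odd j by apply: par; rewrite /c; lia.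
  have : odd (csub n j c.+2./2.*2) = odd j by apply: par; rewrite /c; lia.
  move: (csub n j c./2.*2) (csub n j c.+2./2.*2) => i0 i2 p2 p0.
  by rewrite /flip p0 p2; move: p0 p2; case: (odd j); lia.
by apply: heffter_of_filling filw _ _; [exact: block_layout | lia | lia].
Qed.

(* Assembling the cases *)
Local Close Scope ring_scope.

Theorem corollary1p6 (n k : nat) (hk : 3 <= k) (hkn : k <= n) :
  (exists A : pf_array 'Z_(heffter_modulus n k k) n,
     integer_relative_heffter A)
  <->
  [\/ odd k /\ (n = 0 %[mod 4] \/ n = 3 %[mod 4]),
      k = 2 %[mod 4] /\ ~~ odd n
    | k = 0 %[mod 4]].
Proof.
have n_gt0 : (0 < n)%N by lia.
split=> [[A /heffter_parity]|].
  rewrite odd_sum_half_block => /(_ n_gt0 ltac:(lia)).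
  case: (boolP (odd k)) => ok.
    by move=> hn; constructor 1; split=> //; lia.
  have [k0|k2] := eqVneq (k %% 4)%N 0%N; first by constructor 3.
  by move=> hn; constructor 2; lia.
case=> [[ok hn]|[k2 n_even]|k0].
- have [k3|k1] : (k %% 4 = 3 \/ k %% 4 = 1)%N by lia.
    have -> : k = (3 + 4 * (k %/ 4))%N by lia.
    case: hn => hn.
      have -> : n = (4 * (n %/ 4))%N by lia.
      by apply: heffter_k3mod4_n0mod4; lia.
    have -> : n = (4 * (n %/ 4) + 3)%N by lia.
    by apply: heffter_k3mod4_n3mod4; lia.
  have -> : k = (5 + 4 * (k %/ 4 - 1))%N by lia.
  case: hn => hn.
    have -> : n = (4 * (n %/ 4))%N by lia.
    by apply: heffter_k1mod4_n0mod4; lia.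
  have -> : n = (4 * (n %/ 4) + 3)%N by lia.
  by apply: heffter_k1mod4_n3mod4; lia.
- have -> : k = (6 + 4 * (k %/ 4 - 1))%N by lia.
  by apply: heffter_k2mod4 => //; lia.
have -> : k = (4 * (k %/ 4))%N by lia.
by apply: heffter_k0mod4; lia.
Qed.
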